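(* Let $\lambda,\mu,\rho,\omega>0$, $C_p=\sqrt{(\lambda+2\mu)/\rho}$, $C_s=\sqrt{\mu/\rho}$. Consider the Schwarz algorithm with general transmission conditions for the time-harmonic Navier equations (defined in the context) in which the operators $\mathcal{S}_1,\mathcal{S}_2$ are chosen to have the $2\times 2$ matrix-valued Fourier symbols $$\widehat{\mathcal S}_1(1,1)=\rho\frac{\lambda_1\omega^2}{k^2-\lambda_1\lambda_2},\qquad \widehat{\mathcal S}_1(1,2)=\mathrm{i}k\rho\left(2C_s^2-\frac{\omega^2}{k^2-\lambda_1\lambda_2}\right),$$ $$\widehat{\mathcal S}_1(2,1)=-\mathrm{i}k\rho\left(2C_s^2-\frac{\omega^2}{k^2-\lambda_1\lambda_2}\right),\qquad \widehat{\mathcal S}_1(2,2)=\rho\frac{\lambda_2\omega^2}{k^2-\lambda_1\lambda_2},$$ $$\widehat{\mathcal S}_2(1,1)=\widehat{\mathcal S}_1(1,1),\quad \widehat{\mathcal S}_2(1,2)=-\widehat{\mathcal S}_1(1,2),\quad \widehat{\mathcal S}_2(2,1)=-\widehat{\mathcal S}_1(2,1),\quad \widehat{\mathcal S}_2(2,2)=\widehat{\mathcal S}_1(2,2).$$ Then for every overlap $\delta\ge 0$ (including $\delta=0$, no overlap) the algorithm converges in two iterations: for any initial guess, the errors satisfy $\hat{\mathbf e}_1^2(\cdot,k)=0$ and $\hat{\mathbf e}_2^2(\cdot,k)=0$ for almost every $k\in\mathbb{R}$.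
   Context: The Navier equations are $-(\Delta^e+\omega^2\rho)\mathbf u=\mathbf f$ on $\mathbb{R}^2$ with $\Delta^e\mathbf u=\mu\Delta\mathbf u+(\lambda+\mu)\nabla(\nabla\cdot\mathbf u)$. The subdomains are $\Omega_1=(-\infty,\delta)\times\mathbb{R}$ and $\Omega_2=(0,\infty)\times\mathbb{R}$, with $\delta\ge0$. From initial guesses $\mathbf u_1^0,\mathbf u_2^0$ (such that the transmission data below are defined), the algorithm solves for $n=1,2,\dots$ $$-(\Delta^e+\omega^2\rho)\mathbf u_j^n=\mathbf f\ \text{in }\Omega_j\ (j=1,2),$$ $$(\mathcal T_1+\mathcal S_1)\mathbf u_1^n=(\mathcal T_1+\mathcal S_1)\mathbf u_2^{n-1}\ \text{at }x=\delta,\qquad (\mathcal T_2+\mathcal S_2)\mathbf u_2^n=(\mathcal T_2+\mathcal S_2)\mathbf u_1^{n-1}\ \text{at }x=0,$$ where $\mathcal T_j\mathbf u=2\mu\frac{\partial\mathbf u}{\partial n_j}+\lambda\mathbf n_j\nabla\cdot\mathbf u+\mu\mathbf n_j\times\nabla\times\mathbf u$ is the traction operator, $\mathbf n_1=(1,0)$ and $\mathbf n_2=(-1,0)$ being the outward normals of $\Omega_1$ and $\Omega_2$ (cross product and curl computed by embedding the plane in $\mathbb{R}^3$). Explicitly $\mathcal T_1\mathbf u=\big((\lambda+2\mu)\partial_xu_1+\lambda\partial_yu_2,\ \mu(\partial_yu_1+\partial_xu_2)\big)$ and $\mathcal T_2=-\mathcal T_1$. The Fourier transform in $y$ is $\hat{\mathbf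 u}(x,k)=\int_{-\infty}^\infty e^{-\mathrm{i}ky}\mathbf u(x,y)\,dy$, and $\mathcal S_j$ acts on the mode $k$ by multiplication with the $2\times2$ matrix $\widehat{\mathcal S}_j(k)$ with entries $\widehat{\mathcal S}_j(a,b)$. Put $\lambda_1=\sqrt{k^2-\omega^2/C_s^2}$, $\lambda_2=\sqrt{k^2-\omega^2/C_p^2}$, with the root taken in $\mathrm{i}\mathbb{R}_+$ when the radicand is negative (these are distinct from the Lamé parameter $\lambda$); one has $k^2-\lambda_1\lambda_2\ne0$ for all real $k$. The errors are $\mathbf e_j^n=\mathbf u-\mathbf u_j^n$; for $n\ge 1$ they satisfy the algorithm with $\mathbf f=0$. The subdomain solutions are those bounded/outgoing at infinity: for $n\ge1$, $\hat{\mathbf e}_1^n(x,k)$ is a solution of the Fourier-transformed homogeneous Navier equations that is a combination (with vector coefficients) of $e^{\lambda_1x}$ and $e^{\lambda_2x}$ only, and $\hat{\mathbf e}_2^n(x,k)$ one that is a combination of $e^{-\lambda_1x}$ and $e^{-\lambda_2x}$ only. *)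

(* Defs.v *)
From Stdlib Require Import Reals.
From Coquelicot Require Import Coquelicot.
Open Scope R_scope.

(** ** Complex scalars, vectors and matrices *)

(* C^2 as a normed space over R; the explicit structure is needed because
   [C] on its own is also a normed module over itself. *)
Definition C2 : NormedModule R_AbsRing :=
  prod_NormedModule R_AbsRing C_R_NormedModule C_R_NormedModule.

Definition vec (a b : C) : C2 := (a, b).
Definition cmp1 (v : C2) : C := fst v.
Definition cmp2 (v : C2) : C := snd v.
Definition cscal (a : C) (v : C2) : C2 :=
  vec (a * cmp1 v)%C (a * cmp2 v)%C.

Record mat2 := Mat2 { m11 : C; m12 : C; m21 : C; m22 : C }.

Definition mulmv (M : mat2) (v : C2) : C2 :=
  vec (m11 M * cmp1 v + m12 M * cmp2 v)%C
      (m21 M * cmp1 v + m22 M * cmp2 v)%C.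

Definition cexp (z : C) : C :=
  (exp (Re z) * cos (Im z), exp (Re z) * sin (Im z)).

(* Square root of a real number, in [0, +oo) or in i(0, +oo). *)
Definition csqrt (r : R) : C :=
  if Rle_dec 0 r then RtoC (sqrt r) else (Ci * RtoC (sqrt (- r)))%C.

(** ** Lebesgue-almost every real number *)

Definition null_set (A : R -> Prop) : Prop :=
  forall eps : R, 0 < eps ->
  exists (a b : nat -> R) (l : R),
    (forall n, a n <= b n) /\
    (forall x, A x -> exists n, a n < x < b n) /\
    is_series (fun n => b n - a n) l /\ l < eps.

Definition ae (P : R -> Prop) : Prop := null_set (fun k => ~ P k).

(** ** Navier and traction operators

   Both are written as functions of the partial derivatives of the field, so
   that the same expression gives the operator in the variables (x, y) and,
   with d/dy replaced by multiplication with ik, its Fourier transform. *)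

(* mu Lap u + (lam + mu) grad (div u), with uxy = d_y d_x u, uyx = d_x d_y u *)
Definition elastic (lam mu : R) (uxx uxy uyx uyy : C2) : C2 :=
  vec (RtoC mu * (cmp1 uxx + cmp1 uyy)
         + RtoC (lam + mu) * (cmp1 uxx + cmp2 uyx))%C
      (RtoC mu * (cmp2 uxx + cmp2 uyy)
         + RtoC (lam + mu) * (cmp1 uxy + cmp2 uyy))%C.

(* 2 mu d_n u + lam n div u + mu n x curl u, with n = (n1, n2); for a plane
   field curl u = (0, 0, c), and n x (0, 0, c) = (n2 c, - n1 c, 0). *)
Definition traction (lam mu n1 n2 : R) (ux uy : C2) : C2 :=
  let div := (cmp1 ux + cmp2 uy)%C in
  let c := (cmp2 ux - cmp1 uy)%C in
  vec (RtoC (2 * mu) * (RtoC n1 * cmp1 ux + RtoC n2 * cmp1 uy)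
         + RtoC lam * RtoC n1 * div + RtoC mu * (RtoC n2 * c))%C
      (RtoC (2 * mu) * (RtoC n1 * cmp2 ux + RtoC n2 * cmp2 uy)
         + RtoC lam * RtoC n2 * div + RtoC mu * (- (RtoC n1 * c)))%C.

(* Vector fields of the plane.  A set Om of reals stands for the vertical
   strip Om x R, and only the values of a field on its strip matter. *)
Definition field := R -> R -> C2.

Definition Omega1 (delta x : R) : Prop := x < delta.
Definition Omega2 (x : R) : Prop := 0 < x.

(* - (Delta^e + omega^2 rho) v = f, pointwise on Om x R *)
Definition navier (lam mu rho omega : R) (Om : R -> Prop) (f v : field) : Prop :=
  exists vx vy vxx vxy vyx vyy : field,
  forall x y : R, Om x ->
    is_derive (fun s => v s y) x (vx x y) /\
    is_derive (fun t => v x t) y (vy x y) /\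
    is_derive (fun s => vx s y) x (vxx x y) /\
    is_derive (fun t => vx x t) y (vxy x y) /\
    is_derive (fun s => vy s y) x (vyx x y) /\
    is_derive (fun t => vy x t) y (vyy x y) /\
    opp (plus (elastic lam mu (vxx x y) (vxy x y) (vyx x y) (vyy x y))
              (cscal (RtoC (omega ^ 2 * rho)) (v x y))) = f x y.

(** ** Fourier transform in y *)

(* The integral of e^(-iky) v(x,y) over y, as a possibly conditionally
   convergent improper integral, has the value w. *)
Definition is_fourier (v : field) (x k : R) (w : C2) : Prop :=
  is_RInt_gen (V := C2)
    (fun y => cscal (cexp (- (Ci * RtoC k * RtoC y))%C) (v x y))
    (Rbar_locally m_infty) (Rbar_locally p_infty) w.

Definition ik (k : R) : C := (Ci * RtoC k)%C.

(* The mode w solves the Fourier-transformed homogeneous Navier equations. *)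
Definition fourier_navier (lam mu rho omega : R) (Om : R -> Prop) (k : R)
    (w : R -> C2) : Prop :=
  exists wx wxx : R -> C2,
  forall x : R, Om x ->
    is_derive w x (wx x) /\
    is_derive wx x (wxx x) /\
    opp (plus (elastic lam mu (wxx x) (cscal (ik k) (wx x))
                 (cscal (ik k) (wx x)) (cscal (ik k) (cscal (ik k) (w x))))
              (cscal (RtoC (omega ^ 2 * rho)) (w x))) = zero.

Definition Cp (lam mu rho : R) : R := sqrt ((lam + 2 * mu) / rho).
Definition Cs (mu rho : R) : R := sqrt (mu / rho).

Definition lambda1 (mu rho omega k : R) : C :=
  csqrt (k ^ 2 - omega ^ 2 / Cs mu rho ^ 2).
Definition lambda2 (lam mu rho omega k : R) : C :=
  csqrt (k ^ 2 - omega ^ 2 / Cp lam mu rho ^ 2).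

(* w is a combination of e^(s lambda1 x) and e^(s lambda2 x) on Om. *)
Definition exp_combination (lam mu rho omega s : R) (Om : R -> Prop) (k : R)
    (w : R -> C2) : Prop :=
  exists a b : C2, forall x : R, Om x ->
    w x = plus (cscal (cexp (RtoC s * lambda1 mu rho omega k * RtoC x)%C) a)
               (cscal (cexp (RtoC s * lambda2 lam mu rho omega k * RtoC x)%C) b).

(* (T + S) w = g at x0 for the mode k, where T is the traction with normal
   (n1, n2) and S has the symbol Sh.  The point x0 may lie on the boundary of
   Om, so the value at x0 is the limit taken from inside Om. *)
Definition transmission_data (lam mu n1 n2 : R) (Sh : R -> mat2)
    (Om : R -> Prop) (x0 k : R) (w : R -> C2) (g : C2) : Prop :=
  exists wx : R -> C2,
    within Om (locally x0) (fun x => is_derive w x (wx x)) /\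
    filterlim
      (fun x => plus (traction lam mu n1 n2 (wx x) (cscal (ik k) (w x)))
                     (mulmv (Sh k) (w x)))
      (within Om (locally x0)) (locally g).

(** ** The Schwarz algorithm *)

Definition error (u : field) (uj : nat -> field) (n : nat) : field :=
  fun x y => minus (u x y) (uj n x y).

(* u is the solution and u1 n, u2 n are the iterates; e1h n, e2h n are Fourier
   transforms of their errors.  For each x, a Fourier transform in y is only
   determined up to a null set of k, hence e1h and e2h are representatives. *)
Record schwarz (lam mu rho omega delta : R) (S1h S2h : R -> mat2)
    (f u : field) (u1 u2 : nat -> field) (e1h e2h : nat -> R -> R -> C2)
    : Prop := {
  schwarz_solution : navier lam mu rho omega (fun _ => True) f u;

  schwarz_navier1 : forall n, (1 <= n)%nat ->
    navier lam mu rho omega (Omega1 delta) f (u1 n);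
  schwarz_navier2 : forall n, (1 <= n)%nat ->
    navier lam mu rho omega Omega2 f (u2 n);

  schwarz_fourier1 : forall n, (1 <= n)%nat -> forall x, Omega1 delta x ->
    ae (fun k => is_fourier (error u u1 n) x k (e1h n x k));
  schwarz_fourier2 : forall n, (1 <= n)%nat -> forall x, Omega2 x ->
    ae (fun k => is_fourier (error u u2 n) x k (e2h n x k));

  (* The initial guesses are used only through their transmission data, so
     they need a Fourier transform only near the interface. *)
  schwarz_init1 : within (Omega1 delta) (locally 0) (fun x =>
    ae (fun k => is_fourier (error u u1 0) x k (e1h 0%nat x k)));
  schwarz_init2 : within Omega2 (locally delta) (fun x =>
    ae (fun k => is_fourier (error u u2 0) x k (e2h 0%nat x k)));

  schwarz_mode1 : forall n, (1 <= n)%nat -> ae (fun k =>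
    fourier_navier lam mu rho omega (Omega1 delta) k (fun x => e1h n x k) /\
    exp_combination lam mu rho omega 1 (Omega1 delta) k (fun x => e1h n x k));
  schwarz_mode2 : forall n, (1 <= n)%nat -> ae (fun k =>
    fourier_navier lam mu rho omega Omega2 k (fun x => e2h n x k) /\
    exp_combination lam mu rho omega (-1) Omega2 k (fun x => e2h n x k));

  schwarz_transmission1 : forall n, (1 <= n)%nat -> ae (fun k =>
    exists g : C2,
      transmission_data lam mu 1 0 S1h (Omega1 delta) delta k
        (fun x => e1h n x k) g /\
      transmission_data lam mu 1 0 S1h Omega2 delta k
        (fun x => e2h (n - 1)%nat x k) g);
  schwarz_transmission2 : forall n, (1 <= n)%nat -> ae (fun k =>
    exists g : C2,
      transmission_data lam mu (-1) 0 S2h Omega2 0 k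
        (fun x => e2h n x k) g /\
      transmission_data lam mu (-1) 0 S2h (Omega1 delta) 0 k
        (fun x => e1h (n - 1)%nat x k) g)
}.

(** ** The optimal symbols *)

Section Symbols.
Variables lam mu rho omega k : R.

Let l1 := lambda1 mu rho omega k.
Let l2 := lambda2 lam mu rho omega k.
Let D := (RtoC (k ^ 2) - l1 * l2)%C.
Let offdiag : C :=
  (Ci * RtoC k * RtoC rho
     * (RtoC (2 * Cs mu rho ^ 2) - RtoC (omega ^ 2) / D))%C.

Definition S1_symbol : mat2 := {|
  m11 := (RtoC rho * (l1 * RtoC (omega ^ 2) / D))%C;
  m12 := offdiag;
  m21 := (- offdiag)%C;
  m22 := (RtoC rho * (l2 * RtoC (omega ^ 2) / D))%C |}.

Definition S2_symbol : mat2 := {|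
  m11 := m11 S1_symbol;
  m12 := (- m12 S1_symbol)%C;
  m21 := (- m21 S1_symbol)%C;
  m22 := m22 S1_symbol |}.

End Symbols.

(* Main.v *)
Require Import Defs.
From Stdlib Require Import Reals Lra Lia.
From Coquelicot Require Import Coquelicot.
Open Scope R_scope.

(** The symbols are chosen so that each transmission operator annihilates the
    waves that leave the opposite subdomain.  Fix a frequency [k] with
    [lambda1] and [lambda2] nonzero, which excludes at most four values of [k].
    An error mode is then a sum of a shear wave and a pressure wave: since
    [lambda1 ^ 2 <> lambda2 ^ 2] the two exponentials are linearly independent,
    so each of them solves the Navier equations by itself, and that fixes the
    direction of its amplitude.  This is the Helmholtz decomposition
    ([helmholtz]).

    Let [s = 1] for the left subdomain and [s = -1] for the right one.  On a
    mode with exponents [t * lambda1] and [t * lambda2], [t = 1] or [-1], the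
    operator T + S with normal [(s, 0)] acts as
    [(1 + s * t) * omega ^ 2 * rho / (k ^ 2 - lambda1 * lambda2)] times a fixed
    vector ([transmission_shear], [transmission_pressure]).  A subdomain
    receives its data from the neighbour, whose modes have [t = - s]; this
    factor then vanishes, so from the second iteration on the data are zero.
    The modes of the subdomain itself have [t = s]; the factor is nonzero and
    the two amplitudes solve a homogeneous linear system whose determinant is
    nonzero because [k ^ 2 <> lambda1 * lambda2] ([csqrt_mult_neq_sqr]).  Hence
    the second error is zero ([schwarz_step]).  The position of the interfaces
    enters only through nonzero exponential factors, which is why any overlap,
    or none, gives the same result. *)

(** * Null sets *)

(** The two covers are interleaved, one at the even and the other at the odd
    indices; the lengths then sum by splitting a power series at [1] into its
    even and odd parts. *)
Lemma null_set_union (A B : R -> Prop) :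
  null_set A -> null_set B -> null_set (fun x => A x \/ B x).
Proof.
  intros HA HB eps Heps.
  destruct (HA (eps / 2) ltac:(lra)) as (a & b & l & Hab & Hcov & Hser & Hl).
  destruct (HB (eps / 2) ltac:(lra)) as (c & d & l' & Hcd & Hcov' & Hser' & Hl').
  pose (mix := fun (p q : nat -> R) n =>
                 if Nat.even n then p (Nat.div2 n) else q (Nat.div2 n)).
  assert (Heven : forall p q n, mix p q (2 * n)%nat = p n).
  { intros p q n; unfold mix.
    now rewrite Nat.even_even, Nat.div2_double. }
  assert (Hodd : forall p q n, mix p q (2 * n + 1)%nat = q n).
  { intros p q n; unfold mix.
    now rewrite Nat.even_odd, Nat.add_1_r, Nat.div2_succ_double. }
  exists (mix a c), (mix b d), (l + 1 * l'). repeat split.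
  - intro n; unfold mix; destruct (Nat.even n); auto.
  - intros x [Hx | Hx].
    + destruct (Hcov x Hx) as [n Hn]; exists (2 * n)%nat; now rewrite !Heven.
    + destruct (Hcov' x Hx) as [n Hn]; exists (2 * n + 1)%nat; now rewrite !Hodd.
  - apply (is_series_ext (fun n => (mix b d n - mix a c n) * 1 ^ n)).
    { intro n; rewrite pow1; apply Rmult_1_r. }
    apply is_pseries_R, is_pseries_odd_even; apply is_pseries_R.
    + apply (is_series_ext (fun n => b n - a n)); [|exact Hser].
      intro n; rewrite !Heven, !pow1; symmetry; apply Rmult_1_r.
    + apply (is_series_ext (fun n => d n - c n)); [|exact Hser'].
      intro n; rewrite !Hodd, !pow1; symmetry; apply Rmult_1_r.
  - lra.
Qed.

Lemma null_set_singleton (c : R) : null_set (fun x => x = c).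
Proof.
  intros eps Heps.
  exists (fun n => match n with O => c - eps / 4 | S _ => c end),
         (fun n => match n with O => c + eps / 4 | S _ => c end), (eps / 2).
  repeat split.
  - intros [|n]; lra.
  - intros x ->; exists O; lra.
  - apply (is_series_decr_1 (K := R_AbsRing) (V := R_NormedModule)).
    replace (plus (eps / 2) _) with (zero : R).
    2: { unfold plus, opp, zero; simpl; lra. }
    apply (is_series_ext (fun _ => 0)); [intro n; symmetry; apply Rminus_diag|].
    apply filterlim_ext with (f := fun _ => 0); [|apply filterlim_const].
    intro n; rewrite sum_n_const; ring.
  - lra.
Qed.

Lemma ae_mono (P Q : R -> Prop) : (forall k, P k -> Q k) -> ae P -> ae Q.
Proof.
  intros H HP eps Heps.
  destruct (HP eps Heps) as (a & b & l & Hab & Hcov & Hrest).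
  exists a, b, l; repeat split; try apply Hrest; auto.
Qed.

Lemma ae_and (P Q : R -> Prop) : ae P -> ae Q -> ae (fun k => P k /\ Q k).
Proof.
  intros HP HQ eps Heps.
  destruct (null_set_union _ _ HP HQ eps Heps) as (a & b & l & Hab & Hcov & Hrest).
  exists a, b, l; repeat split; try apply Hrest; auto.
  intros x Hx; apply Hcov.
  destruct (Classical_Prop.classic (P x)); tauto.
Qed.

Lemma ae_sqr_neq (c : R) : ae (fun k => k ^ 2 <> c).
Proof.
  assert (H : forall a, ae (fun k => k <> a)).
  { intros a eps Heps.
    destruct (null_set_singleton a eps Heps) as (u & v & l & Huv & Hcov & Hrest).
    exists u, v, l; repeat split; try apply Hrest; auto.
    intros x Hx; apply Hcov; lra. }
  generalize (ae_and _ _ (H (sqrt c)) (H (- sqrt c))); apply ae_mono.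
  intros k [H1 H2] <-.
  replace (k ^ 2) with (Rsqr k) in * by (unfold Rsqr; ring).
  rewrite sqrt_Rsqr_abs in *.
  unfold Rabs in *; destruct (Rcase_abs k); lra.
Qed.

(** * Sums of two exponential modes *)

Definition bimode (p q : C) (a b : C2) (x : R) : C2 :=
  plus (cscal (cexp (p * RtoC x)%C) a) (cscal (cexp (q * RtoC x)%C) b).

Lemma vec_ext (v w : C2) : cmp1 v = cmp1 w -> cmp2 v = cmp2 w -> v = w.
Proof. destruct v, w; simpl; congruence. Qed.

Lemma cmp1_plus (v w : C2) : cmp1 (plus v w) = (cmp1 v + cmp1 w)%C.
Proof. reflexivity. Qed.

Lemma cmp2_plus (v w : C2) : cmp2 (plus v w) = (cmp2 v + cmp2 w)%C.
Proof. reflexivity. Qed.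

Lemma cmp1_opp (v : C2) : cmp1 (opp v) = (- cmp1 v)%C.
Proof. reflexivity. Qed.

Lemma cmp2_opp (v : C2) : cmp2 (opp v) = (- cmp2 v)%C.
Proof. reflexivity. Qed.

Lemma cmp1_zero : cmp1 zero = 0%C.
Proof. reflexivity. Qed.

Lemma cmp2_zero : cmp2 zero = 0%C.
Proof. reflexivity. Qed.

Lemma cmp1_vec (a b : C) : cmp1 (vec a b) = a.
Proof. reflexivity. Qed.

Lemma cmp2_vec (a b : C) : cmp2 (vec a b) = b.
Proof. reflexivity. Qed.

Ltac components :=
  unfold elastic, traction, mulmv, cscal in *; cbv zeta in *;
  repeat rewrite ?cmp1_plus, ?cmp2_plus, ?cmp1_opp, ?cmp2_opp, ?cmp1_zero,
    ?cmp2_zero, ?cmp1_vec, ?cmp2_vec in *.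

Lemma C2_eq (v w : C2) : v = w -> cmp1 v = cmp1 w /\ cmp2 v = cmp2 w.
Proof. intros ->; auto. Qed.

Lemma Cmult_eq_0_r (c z : C) : c <> 0%C -> (c * z)%C = 0%C -> z = 0%C.
Proof.
  intros Hc H. replace z with (/ c * (c * z))%C by (field; exact Hc).
  rewrite H; ring.
Qed.

Lemma cexp_neq_0 (z : C) : cexp z <> 0%C.
Proof.
  intro H; unfold cexp in H; injection H as H1 H2.
  generalize (exp_pos (Re z)) (sin2_cos2 (Im z)); unfold Rsqr; intros Hp Hs.
  apply Rmult_integral in H1; apply Rmult_integral in H2.
  destruct H1 as [H1|H1]; [lra|]; destruct H2 as [H2|H2]; [lra|].
  rewrite H1, H2 in Hs; lra.
Qed.

(** The real differentiation rules apply once the complex multiple of [a] is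
    written as a combination of [a] and [Ci * a] with real coefficients. *)
Lemma is_derive_cexp_cscal (p : C) (a : C2) (x : R) :
  is_derive (V := C2) (fun t => cscal (cexp (p * RtoC t)%C) a) x
            (cscal (cexp (p * RtoC x)%C) (cscal p a)).
Proof.
  destruct p as [al be].
  pose (c := fun t => exp (al * t) * cos (be * t)).
  pose (s := fun t => exp (al * t) * sin (be * t)).
  assert (Hcs : forall t, cexp ((al, be) * RtoC t)%C = (c t, s t)).
  { intro t; unfold cexp, c, s; simpl.
    replace (al * t - be * 0) with (al * t) by ring.
    now replace (al * 0 + be * t) with (be * t) by ring. }
  apply is_derive_ext with
    (f := fun t => plus (scal (c t) a) (scal (s t) (cscal Ci a))).
  { intro t; rewrite Hcs. destruct a as [[a1 a2] [a3 a4]].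
    apply injective_projections; apply injective_projections; cbn; ring. }
  rewrite Hcs.
  replace (cscal _ (cscal _ a)) with
    (plus (scal (al * c x - be * s x) a) (scal (be * c x + al * s x) (cscal Ci a))).
  2: { destruct a as [[a1 a2] [a3 a4]].
    apply injective_projections; apply injective_projections; cbn; ring. }
  apply (is_derive_plus (V := C2)).
  - apply (is_derive_scal_l (V := C2) c). unfold c; auto_derive; [trivial|].
    unfold s; ring.
  - apply (is_derive_scal_l (V := C2) s). unfold s; auto_derive; [trivial|].
    unfold c; ring.
Qed.

Lemma is_derive_bimode (p q : C) (a b : C2) (x : R) :
  is_derive (V := C2) (bimode p q a b) x (bimode p q (cscal p a) (cscal q b) x).
Proof. apply (is_derive_plus (V := C2)); apply is_derive_cexp_cscal. Qed.

Lemma is_derive_fst (U V : NormedModule R_AbsRing)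
    (w : R -> prod_NormedModule R_AbsRing U V) (x : R) l :
  is_derive w x l -> is_derive (fun t => fst (w t)) x (fst l).
Proof.
  intro H.
  apply (filterdiff_comp' w fst x _ fst H).
  apply filterdiff_linear, is_linear_fst.
Qed.

Lemma is_derive_snd (U V : NormedModule R_AbsRing)
    (w : R -> prod_NormedModule R_AbsRing U V) (x : R) l :
  is_derive w x l -> is_derive (fun t => snd (w t)) x (snd l).
Proof.
  intro H.
  apply (filterdiff_comp' w snd x _ snd H).
  apply filterdiff_linear, is_linear_snd.
Qed.

Lemma is_derive_C2_unique (w : R -> C2) (x : R) (l l' : C2) :
  is_derive w x l -> is_derive w x l' -> l = l'.
Proof.
  intros H H'.
  assert (HR : forall (g : R -> R) m m', is_derive g x m -> is_derive g x m' -> m = m').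
  { intros g m m' Hm Hm'.
    now rewrite <- (is_derive_unique _ _ _ Hm), <- (is_derive_unique _ _ _ Hm'). }
  assert (HC : forall (g : R -> C_R_NormedModule) m m',
             is_derive g x m -> is_derive g x m' -> m = m').
  { intros g m m' Hm Hm'; apply injective_projections.
    - apply (HR (fun t => fst (g t))); now apply is_derive_fst.
    - apply (HR (fun t => snd (g t))); now apply is_derive_snd. }
  apply injective_projections.
  - apply (HC (fun t => fst (w t))); now apply is_derive_fst.
  - apply (HC (fun t => snd (w t))); now apply is_derive_snd.
Qed.

(** Fields are only controlled on their subdomain, which is open, so their
    derivatives there can be read off any formula valid on it. *)
Lemma is_derive_eq_on (Om : R -> Prop) (w v : R -> C2) (x : R) (l l' : C2) :
  open Om -> Om x -> (forall y, Om y -> w y = v y) ->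
  is_derive w x l -> is_derive v x l' -> l = l'.
Proof.
  intros Hopen Hx Hwv Hw Hv.
  apply (is_derive_C2_unique v x); [|exact Hv].
  apply (is_derive_ext_loc w); [|exact Hw].
  apply (filter_imp Om); [exact Hwv|]. now apply Hopen.
Qed.

(** Differentiating the vanishing sum gives a second linear relation between
    the two modes, with determinant [q - p]. *)
Lemma bimode_eq_0 (p q : C) (a b : C2) (Om : R -> Prop) (x0 : R) :
  p <> q -> open Om -> Om x0 -> (forall x, Om x -> bimode p q a b x = zero) ->
  a = zero /\ b = zero.
Proof.
  intros Hpq Hopen Hx0 H0.
  assert (H1 : bimode p q (cscal p a) (cscal q b) x0 = zero).
  { apply (is_derive_eq_on Om (bimode p q a b) (fun _ => zero) x0); auto.
    - apply is_derive_bimode.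
    - apply (is_derive_const (V := C2)). }
  specialize (H0 x0 Hx0). unfold bimode in *.
  generalize (cexp_neq_0 (p * RtoC x0)) (cexp_neq_0 (q * RtoC x0)).
  revert H0 H1; generalize (cexp (p * RtoC x0)) (cexp (q * RtoC x0)).
  assert (Hpq' : (p - q)%C <> 0%C).
  { intro H; apply Hpq. replace p with (p - q + q)%C by ring. rewrite H; ring. }
  assert (Hsc : forall s t u v : C, s <> 0%C -> t <> 0%C ->
            (s * u + t * v)%C = 0%C -> (s * (p * u) + t * (q * v))%C = 0%C ->
            u = 0%C /\ v = 0%C).
  { intros s t u v Hs Ht E1 E2. split.
    - apply (Cmult_eq_0_r ((p - q) * s)%C); [now apply Cmult_neq_0|].
      replace ((p - q) * s * u)%C
        with (s * (p * u) + t * (q * v) - q * (s * u + t * v))%C by ring.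
      rewrite E1, E2; ring.
    - apply (Cmult_eq_0_r ((p - q) * t)%C); [now apply Cmult_neq_0|].
      replace ((p - q) * t * v)%C
        with (p * (s * u + t * v) - (s * (p * u) + t * (q * v)))%C by ring.
      rewrite E1, E2; ring. }
  intros E F E0 E1 HE HF.
  apply C2_eq in E0, E1. destruct E0 as [E01 E02], E1 as [E11 E12].
  destruct (Hsc E F (cmp1 a) (cmp1 b) HE HF E01 E11).
  destruct (Hsc E F (cmp2 a) (cmp2 b) HE HF E02 E12).
  split; apply vec_ext; assumption.
Qed.

(** * Dispersion relations *)

Lemma Ci_sqr : (Ci * Ci)%C = (- RtoC 1)%C.
Proof. apply injective_projections; simpl; ring. Qed.

Lemma csqrt_sqr (r : R) : (csqrt r * csqrt r)%C = RtoC r.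
Proof.
  unfold csqrt; destruct (Rle_dec 0 r) as [H|H].
  - now rewrite <- RtoC_mult, sqrt_sqrt.
  - replace (Ci * RtoC (sqrt (- r)) * (Ci * RtoC (sqrt (- r))))%C
      with (Ci * Ci * (RtoC (sqrt (- r)) * RtoC (sqrt (- r))))%C by ring.
    rewrite Ci_sqr, <- RtoC_mult, sqrt_sqrt by lra.
    apply injective_projections; simpl; ring.
Qed.

Lemma csqrt_neq_0 (r : R) : r <> 0 -> csqrt r <> 0%C.
Proof.
  intros Hr H. apply Hr, RtoC_inj. rewrite <- csqrt_sqr, H; ring.
Qed.

Lemma csqrt_mult_neg (r s : R) : r < 0 -> s < 0 ->
  (csqrt r * csqrt s)%C = RtoC (- (sqrt (- r) * sqrt (- s))).
Proof.
  intros Hr Hs; unfold csqrt.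
  destruct (Rle_dec 0 r); [lra|]; destruct (Rle_dec 0 s); [lra|].
  apply injective_projections; simpl; ring.
Qed.

(** Squaring [K = csqrt (K - p) * csqrt (K - q)], where [K = k ^ 2], forces [K] to
    be below both [p] and [q].  Both roots are then imaginary with positive
    imaginary part, so their product is negative and cannot equal [K]. *)
Lemma csqrt_mult_neq_sqr (k p q : R) : 0 < p -> 0 < q ->
  (RtoC (k ^ 2) - csqrt (k ^ 2 - p) * csqrt (k ^ 2 - q))%C <> 0%C.
Proof.
  intros Hp Hq H.
  assert (E : (csqrt (k ^ 2 - p) * csqrt (k ^ 2 - q))%C = RtoC (k ^ 2)).
  { replace (RtoC (k ^ 2)) with
      (RtoC (k ^ 2) - csqrt (k ^ 2 - p) * csqrt (k ^ 2 - q)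
         + csqrt (k ^ 2 - p) * csqrt (k ^ 2 - q))%C by ring.
    rewrite H; ring. }
  (* equivalently [p * q = k ^ 2 * (p + q)], so [k ^ 2] is below [p] and [q] *)
  assert (E2 : (k ^ 2 - p) * (k ^ 2 - q) = k ^ 2 * k ^ 2).
  { apply RtoC_inj. rewrite !RtoC_mult, <- E, <- !csqrt_sqr; ring. }
  assert (Hk : 0 <= k ^ 2) by apply pow2_ge_0.
  revert E2 E Hk H; generalize (k ^ 2); intros K E2 E HK _.
  assert (K < p) by nra. assert (K < q) by nra.
  rewrite csqrt_mult_neg in E by lra. apply RtoC_inj in E.
  assert (0 < sqrt (- (K - p))) by (apply sqrt_lt_R0; lra).
  assert (0 < sqrt (- (K - q))) by (apply sqrt_lt_R0; lra).
  nra.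
Qed.

Section Mode.

Variables lam mu rho omega k : R.
Hypotheses (hlam : 0 < lam) (hmu : 0 < mu) (hrho : 0 < rho) (homega : 0 < omega).

Let l1 := lambda1 mu rho omega k.
Let l2 := lambda2 lam mu rho omega k.
Let D := (RtoC (k ^ 2) - l1 * l2)%C.
Let N := RtoC (omega ^ 2 * rho).

Lemma Cs_sqr : Cs mu rho ^ 2 = mu / rho.
Proof.
  unfold Cs. rewrite <- Rsqr_pow2, Rsqr_sqrt; [reflexivity|].
  apply Rlt_le, Rdiv_lt_0_compat; lra.
Qed.

Lemma Cp_sqr : Cp lam mu rho ^ 2 = (lam + 2 * mu) / rho.
Proof.
  unfold Cp. rewrite <- Rsqr_pow2, Rsqr_sqrt; [reflexivity|].
  apply Rlt_le, Rdiv_lt_0_compat; lra.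
Qed.

Lemma lambda1_dispersion :
  (RtoC mu * (RtoC k * RtoC k - l1 * l1))%C = N.
Proof.
  unfold l1, lambda1, N. rewrite csqrt_sqr, Cs_sqr.
  rewrite <- RtoC_mult, <- RtoC_minus, <- RtoC_mult.
  f_equal; field; lra.
Qed.

Lemma lambda2_dispersion :
  ((RtoC lam + RtoC 2 * RtoC mu) * (RtoC k * RtoC k - l2 * l2))%C = N.
Proof.
  unfold l2, lambda2, N. rewrite csqrt_sqr, Cp_sqr.
  rewrite <- !RtoC_mult, <- RtoC_plus, <- RtoC_minus, <- RtoC_mult.
  f_equal; field; lra.
Qed.

Lemma symbol_denominator_neq_0 : D <> 0%C.
Proof.
  unfold D, l1, l2, lambda1, lambda2. rewrite Cs_sqr, Cp_sqr.
  apply csqrt_mult_neq_sqr; apply Rdiv_lt_0_compat;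
    try apply Rdiv_lt_0_compat; nra.
Qed.

Lemma lambda1_sqr_neq_lambda2_sqr : (l1 * l1)%C <> (l2 * l2)%C.
Proof.
  unfold l1, l2, lambda1, lambda2. rewrite !csqrt_sqr, Cs_sqr, Cp_sqr.
  intro H; apply RtoC_inj in H.
  assert (E : omega ^ 2 * rho * (lam + mu) = 0).
  { replace (omega ^ 2 * rho * (lam + mu)) with
      (mu * (lam + 2 * mu) * ((k ^ 2 - omega ^ 2 / ((lam + 2 * mu) / rho))
          - (k ^ 2 - omega ^ 2 / (mu / rho)))) by (field; lra).
    rewrite H; ring. }
  assert (0 < omega ^ 2) by nra. assert (0 < omega ^ 2 * rho) by nra. nra.
Qed.

(** * Polarisation *)

Lemma ik_sqr : (ik k * ik k)%C = (- (RtoC k * RtoC k))%C.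
Proof.
  unfold ik. replace (Ci * RtoC k * (Ci * RtoC k))%C
    with (Ci * Ci * (RtoC k * RtoC k))%C by ring.
  rewrite Ci_sqr; ring.
Qed.

(** The transformed Navier operator applied to [exp (r * x)] times the
    amplitude [v], with the exponential factored out. *)
Definition navier_symbol (r : C) (v : C2) : C2 :=
  opp (plus (elastic lam mu (cscal r (cscal r v)) (cscal (ik k) (cscal r v))
               (cscal (ik k) (cscal r v)) (cscal (ik k) (cscal (ik k) v)))
            (cscal N v)).

(** Amplitudes of the divergence-free and of the curl-free wave with
    exponent [r], up to the constant factor: the rotated gradient and the
    gradient of [exp (r * x + i * k * y)]. *)
Definition shear (r : C) : C2 := vec (ik k) (- r)%C.
Definition pressure (r : C) : C2 := vec r (ik k).

(** At a shear exponent the Navier symbol reduces to minus [lam + mu] times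
    the gradient of the divergence, so its first component says that
    [r * (r * v1 + ik * v2)] vanishes. *)
Lemma shear_polarisation (r : C) (v : C2) :
  r <> 0%C -> (r * r)%C = (l1 * l1)%C -> navier_symbol r v = zero ->
  exists A, v = cscal A (shear r).
Proof.
  intros Hr Er H; apply C2_eq in H; destruct H as [H _].
  assert (HI : (ik k * ik k + RtoC k * RtoC k)%C = 0%C) by (rewrite ik_sqr; ring).
  assert (HN : (RtoC mu * (RtoC k * RtoC k - r * r) - N)%C = 0%C)
    by (rewrite Er, lambda1_dispersion; ring).
  assert (Hlm : RtoC (lam + mu) <> 0%C) by (intro E; apply RtoC_inj in E; lra).
  assert (Hv : (r * cmp1 v + ik k * cmp2 v)%C = 0%C).
  { apply (Cmult_eq_0_r (RtoC (lam + mu) * r)%C); [now apply Cmult_neq_0|].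
    transitivity (- cmp1 (navier_symbol r v)
      - RtoC mu * cmp1 v * (ik k * ik k + RtoC k * RtoC k)
      + cmp1 v * (RtoC mu * (RtoC k * RtoC k - r * r) - N))%C.
    - unfold navier_symbol; components; ring.
    - rewrite H, HI, HN; components; ring. }
  exists (- cmp2 v / r)%C. unfold shear; apply vec_ext; components.
  - transitivity ((r * cmp1 v + ik k * cmp2 v - ik k * cmp2 v) / r)%C.
    + field; exact Hr.
    + rewrite Hv; field; exact Hr.
  - field; exact Hr.
Qed.

(** At a pressure exponent only the curl survives: the second component
    says that [r * (ik * v1 - r * v2)] vanishes. *)
Lemma pressure_polarisation (r : C) (v : C2) :
  r <> 0%C -> (r * r)%C = (l2 * l2)%C -> navier_symbol r v = zero ->
  exists B, v = cscal B (pressure r).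
Proof.
  intros Hr Er H; apply C2_eq in H; destruct H as [_ H].
  assert (HI : (ik k * ik k + RtoC k * RtoC k)%C = 0%C) by (rewrite ik_sqr; ring).
  assert (HN : ((RtoC lam + RtoC 2 * RtoC mu) * (RtoC k * RtoC k - r * r) - N)%C = 0%C)
    by (rewrite Er, lambda2_dispersion; ring).
  assert (Hlm : RtoC (lam + mu) <> 0%C) by (intro E; apply RtoC_inj in E; lra).
  assert (Hv : (ik k * cmp1 v - r * cmp2 v)%C = 0%C).
  { apply (Cmult_eq_0_r (RtoC (lam + mu) * r)%C); [now apply Cmult_neq_0|].
    transitivity (- cmp2 (navier_symbol r v)
      - (RtoC lam + RtoC 2 * RtoC mu) * cmp2 v * (ik k * ik k + RtoC k * RtoC k)
      + cmp2 v * ((RtoC lam + RtoC 2 * RtoC mu) * (RtoC k * RtoC k - r * r) - N))%C.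
    - unfold navier_symbol; components. rewrite RtoC_plus; ring.
    - rewrite H, HI, HN; components; ring. }
  exists (cmp1 v / r)%C. unfold pressure; apply vec_ext; components.
  - field; exact Hr.
  - transitivity ((ik k * cmp1 v - (ik k * cmp1 v - r * cmp2 v)) / r)%C.
    + field; exact Hr.
    + rewrite Hv; field; exact Hr.
Qed.

Lemma sign_exponent (t : R) (l : C) : t * t = 1 -> l <> 0%C ->
  (RtoC t * l)%C <> 0%C /\ (RtoC t * l * (RtoC t * l))%C = (l * l)%C.
Proof.
  intros Ht Hl. split.
  - apply Cmult_neq_0; [|exact Hl]. intro H; apply RtoC_inj in H; nra.
  - replace (RtoC t * l * (RtoC t * l))%C
      with (RtoC t * RtoC t * (l * l))%C by ring.
    rewrite <- RtoC_mult, Ht; ring.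
Qed.

(** [t = 1] for the left half-plane and [t = -1] for the right one. *)
Definition outgoing (t : R) (A B : C) : R -> C2 :=
  bimode (RtoC t * l1) (RtoC t * l2)
    (cscal A (shear (RtoC t * l1))) (cscal B (pressure (RtoC t * l2))).

Hypotheses (hl1 : l1 <> 0%C) (hl2 : l2 <> 0%C).

Lemma helmholtz (t : R) (Om : R -> Prop) (x0 : R) (w : R -> C2) :
  t * t = 1 -> open Om -> Om x0 ->
  fourier_navier lam mu rho omega Om k w ->
  exp_combination lam mu rho omega t Om k w ->
  exists A B : C, forall x, Om x -> w x = outgoing t A B x.
Proof.
  intros Ht Hopen Hx0 (wx & wxx & Hw) (a & b & Hab).
  fold l1 l2 in Hab. unfold outgoing.
  destruct (sign_exponent t l1 Ht hl1) as [Hp Ep].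
  destruct (sign_exponent t l2 Ht hl2) as [Hq Eq].
  set (p := (RtoC t * l1)%C) in *. set (q := (RtoC t * l2)%C) in *.
  change (forall x, Om x -> w x = bimode p q a b x) in Hab.
  assert (Hpq : p <> q).
  { intro H. apply lambda1_sqr_neq_lambda2_sqr. now rewrite <- Ep, <- Eq, H. }
  assert (D1 : forall x, Om x -> wx x = bimode p q (cscal p a) (cscal q b) x).
  { intros x Hx. apply (is_derive_eq_on Om w (bimode p q a b) x); auto.
    - now apply Hw.
    - apply is_derive_bimode. }
  assert (D2 : forall x, Om x ->
      wxx x = bimode p q (cscal p (cscal p a)) (cscal q (cscal q b)) x).
  { intros x Hx.
    apply (is_derive_eq_on Om wx (bimode p q (cscal p a) (cscal q b)) x); auto.
    - now apply Hw.
    - apply is_derive_bimode. }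
  destruct (bimode_eq_0 p q (navier_symbol p a) (navier_symbol q b) Om x0)
    as [La Lb]; auto.
  { intros x Hx. destruct (Hw x Hx) as (_ & _ & E).
    rewrite (D1 x Hx), (D2 x Hx), (Hab x Hx) in E.
    etransitivity; [|exact E].
    unfold navier_symbol, bimode, N. apply vec_ext; components; ring. }
  destruct (shear_polarisation p a Hp Ep La) as [A HA].
  destruct (pressure_polarisation q b Hq Eq Lb) as [B HB].
  exists A, B. rewrite <- HA, <- HB. exact Hab.
Qed.

(** * Transmission operators on outgoing modes *)

(** The two given symbols differ only in the sign of the off-diagonal
    entries, which is the sign of the normal; keeping it as a parameter treats
    both subdomains at once. *)
Definition signed_symbol (s : R) : mat2 :=
  let S1 := S1_symbol lam mu rho omega k in
  Mat2 (m11 S1) (RtoC s * m12 S1)%C (RtoC s * m21 S1)%C (m22 S1).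

(** The operator T + S applied to [exp (r * x)] times the amplitude [v], with
    the exponential factored out. *)
Definition transmission_symbol (s : R) (r : C) (v : C2) : C2 :=
  plus (traction lam mu s 0 (cscal r v) (cscal (ik k) v))
       (mulmv (signed_symbol s) v).

Lemma signed_symbol_eq (s : R) :
  signed_symbol s =
    let z := (ik k * (RtoC 2 * RtoC mu - N / D))%C in
    Mat2 (N * l1 / D)%C (RtoC s * z)%C (- (RtoC s * z))%C (N * l2 / D)%C.
Proof.
  assert (HD := symbol_denominator_neq_0).
  assert (Hr : RtoC rho <> 0%C) by (intro E; apply RtoC_inj in E; lra).
  unfold signed_symbol, S1_symbol; cbn [m11 m12 m21 m22]. fold l1 l2; fold D.
  rewrite Cs_sqr. unfold N, ik.
  replace (2 * (mu / rho)) with (2 * mu / rho) by (field; lra).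
  rewrite RtoC_div, !RtoC_mult by lra.
  cbv zeta; f_equal; field; auto.
Qed.

(** Zero for waves coming from the neighbour ([t = - s]) and nonzero for the
    subdomain's own waves ([t = s]). *)
Definition gain (s t : R) : C := ((RtoC 1 + RtoC s * RtoC t) * N / D)%C.

(** In both lemmas below one component is a polynomial identity.  The other
    one holds modulo the dispersion relation, [t * t = 1], [ik * ik = - k * k] and
    the definition of the denominator [D]; the proof displays the
    combination of these relations that closes it. *)
Lemma transmission_shear (s t : R) : t * t = 1 ->
  transmission_symbol s (RtoC t * l1) (shear (RtoC t * l1))
  = cscal (gain s t) (vec (ik k * l1)%C (- (RtoC t * l1 * l2))%C).
Proof.
  intros Ht.
  assert (HD := symbol_denominator_neq_0).
  assert (HI : (ik k * ik k + RtoC k * RtoC k)%C = 0%C) by (rewrite ik_sqr; ring).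
  assert (HN : (RtoC mu * (RtoC k * RtoC k - l1 * l1) - N)%C = 0%C)
    by (rewrite lambda1_dispersion; ring).
  assert (Htt : (RtoC t * RtoC t - 1)%C = 0%C) by (rewrite <- RtoC_mult, Ht; ring).
  assert (HE : ((RtoC k * RtoC k - l1 * l2) * / D - 1)%C = 0%C).
  { replace (RtoC k * RtoC k)%C with (D + l1 * l2)%C; [field; exact HD|].
    unfold D. rewrite <- RtoC_mult. replace (k ^ 2) with (k * k) by ring. ring. }
  unfold transmission_symbol, gain, shear; rewrite signed_symbol_eq.
  apply vec_ext; components; cbn [m11 m12 m21 m22]; unfold Cdiv in *;
    revert HI HN Htt HE; rewrite ?RtoC_mult;
    generalize (/ D)%C (ik k); intros E I HI HN Htt HE.
  - ring.
  - match goal with |- _ = ?r => transitivity (r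
      + (RtoC t * RtoC t - 1) * RtoC s * (N * E * l1 * l2 - RtoC mu * (l1 * l1))
      + (I * I + RtoC k * RtoC k) * RtoC s * (N * E - RtoC mu)
      + (RtoC mu * (RtoC k * RtoC k - l1 * l1) - N) * RtoC s
      - ((RtoC k * RtoC k - l1 * l2) * E - 1) * RtoC s * N)%C end.
    + ring.
    + rewrite HI, HN, Htt, HE; ring.
Qed.

Lemma transmission_pressure (s t : R) : t * t = 1 ->
  transmission_symbol s (RtoC t * l2) (pressure (RtoC t * l2))
  = cscal (gain s t) (vec (RtoC t * l1 * l2)%C (ik k * l2)%C).
Proof.
  intros Ht.
  assert (HD := symbol_denominator_neq_0).
  assert (HI : (ik k * ik k + RtoC k * RtoC k)%C = 0%C) by (rewrite ik_sqr; ring).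
  assert (HN : ((RtoC lam + RtoC 2 * RtoC mu) * (RtoC k * RtoC k - l2 * l2) - N)%C = 0%C)
    by (rewrite lambda2_dispersion; ring).
  assert (Htt : (RtoC t * RtoC t - 1)%C = 0%C) by (rewrite <- RtoC_mult, Ht; ring).
  assert (HE : ((RtoC k * RtoC k - l1 * l2) * / D - 1)%C = 0%C).
  { replace (RtoC k * RtoC k)%C with (D + l1 * l2)%C; [field; exact HD|].
    unfold D. rewrite <- RtoC_mult. replace (k ^ 2) with (k * k) by ring. ring. }
  unfold transmission_symbol, gain, pressure; rewrite signed_symbol_eq.
  apply vec_ext; components; cbn [m11 m12 m21 m22]; unfold Cdiv in *;
    revert HI HN Htt HE; rewrite ?RtoC_mult;
    generalize (/ D)%C (ik k); intros E I HI HN Htt HE.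
  - match goal with |- _ = ?r => transitivity (r
      + (RtoC t * RtoC t - 1) * RtoC s
          * ((RtoC lam + RtoC 2 * RtoC mu) * (l2 * l2) - N * E * l1 * l2)
      + (I * I + RtoC k * RtoC k) * RtoC s
          * (RtoC lam + RtoC 2 * RtoC mu - N * E)
      - ((RtoC lam + RtoC 2 * RtoC mu) * (RtoC k * RtoC k - l2 * l2) - N) * RtoC s
      + ((RtoC k * RtoC k - l1 * l2) * E - 1) * RtoC s * N)%C end.
    + ring.
    + rewrite HI, HN, Htt, HE; ring.
  - ring.
Qed.

Lemma transmission_symbol_scal (s : R) (r A : C) (v : C2) :
  transmission_symbol s r (cscal A v) = cscal A (transmission_symbol s r v).
Proof. unfold transmission_symbol; apply vec_ext; components; ring. Qed.

(** The trace at [x0] is a limit from inside [Om], where the datum is again a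
    sum of exponentials; these are continuous across [x0], so the limit is
    their value there. *)
Lemma transmission_bimode (s : R) (Sh : R -> mat2) (Om : R -> Prop) (x0 : R)
    (w : R -> C2) (p q : C) (a b g : C2) :
  Sh k = signed_symbol s ->
  open Om -> ProperFilter' (within Om (locally x0)) ->
  (forall x, Om x -> w x = bimode p q a b x) ->
  transmission_data lam mu s 0 Sh Om x0 k w g ->
  g = bimode p q (transmission_symbol s p a) (transmission_symbol s q b) x0.
Proof.
  intros HS Hopen Hproper Hw (wx & Hder & Hlim).
  set (G := bimode p q (transmission_symbol s p a) (transmission_symbol s q b)).
  refine (filterlim_locally_unique (FF := Hproper) _ _ _ Hlim _).
  apply (filterlim_ext_loc G).
  - revert Hder; unfold within; apply filter_imp; intros x Hder HOm.
    assert (Hx := Hder HOm).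
    assert (Ex : wx x = bimode p q (cscal p a) (cscal q b) x).
    { apply (is_derive_eq_on Om w (bimode p q a b) x); auto.
      apply is_derive_bimode. }
    rewrite Ex, (Hw x HOm), HS.
    unfold G, bimode, transmission_symbol; apply vec_ext; components; ring.
  - apply (filterlim_filter_le_1 G (filter_le_within (F := locally x0) Om)).
    apply (ex_derive_continuous (V := C2) G x0).
    eexists; apply is_derive_bimode.
Qed.

Lemma outgoing_trace (s t : R) (Sh : R -> mat2) (Om : R -> Prop) (x0 : R)
    (w : R -> C2) (A B : C) (g : C2) :
  t * t = 1 -> Sh k = signed_symbol s ->
  open Om -> ProperFilter (within Om (locally x0)) ->
  (forall x, Om x -> w x = outgoing t A B x) ->
  transmission_data lam mu s 0 Sh Om x0 k w g ->
  exists E F : C, E <> 0%C /\ F <> 0%C /\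
    g = cscal (gain s t)
          (vec (l1 * (ik k * (E * A) + RtoC t * l2 * (F * B)))%C
               (l2 * (ik k * (F * B) - RtoC t * l1 * (E * A)))%C).
Proof.
  intros Ht HS Hopen Hproper Hw Hg.
  apply Proper_StrongProper in Hproper.
  rewrite (transmission_bimode s Sh Om x0 w _ _ _ _ g HS Hopen Hproper Hw Hg).
  exists (cexp (RtoC t * l1 * RtoC x0)%C), (cexp (RtoC t * l2 * RtoC x0)%C).
  repeat split; try apply cexp_neq_0.
  rewrite !transmission_symbol_scal, transmission_shear, transmission_pressure by exact Ht.
  unfold bimode; apply vec_ext; components; ring.
Qed.

Lemma gain_neq_0 (s : R) : s * s = 1 -> gain s s <> 0%C.
Proof.
  intros Hs H. unfold gain in H. rewrite <- RtoC_mult, Hs, <- RtoC_plus in H.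
  assert (HD := symbol_denominator_neq_0).
  assert (HN : (RtoC (1 + 1) * N)%C = 0%C).
  { transitivity (RtoC (1 + 1) * N / D * D)%C; [field; exact HD|].
    rewrite H; ring. }
  unfold N in HN. rewrite <- RtoC_mult in HN. apply RtoC_inj in HN.
  assert (0 < omega ^ 2) by nra. nra.
Qed.

(** [w] is the new error on [Om] and [w'] the previous error of the
    neighbour.  The datum [g] vanishes because [w'] has the opposite sign, and
    then the amplitudes of [w] solve a system of determinant [- D]. *)
Lemma schwarz_step (s t : R) (Sh : R -> mat2) (Om Om' : R -> Prop) (x0 : R)
    (w w' : R -> C2) (g : C2) :
  s * s = 1 -> t = - s -> Sh k = signed_symbol s -> open Om -> open Om' ->
  ProperFilter (within Om (locally x0)) ->
  ProperFilter (within Om' (locally x0)) ->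
  fourier_navier lam mu rho omega Om k w /\
    exp_combination lam mu rho omega s Om k w ->
  fourier_navier lam mu rho omega Om' k w' /\
    exp_combination lam mu rho omega t Om' k w' ->
  transmission_data lam mu s 0 Sh Om x0 k w g ->
  transmission_data lam mu s 0 Sh Om' x0 k w' g ->
  forall x, Om x -> w x = zero.
Proof.
  intros Hs -> HS Hopen Hopen' Hp Hp' [HN HE0] [HN' HE0'] Hg Hg' x Hx.
  destruct (@filter_ex _ _ Hp' Om') as [x' Hx'];
    [unfold within; now apply filter_forall|].
  destruct (helmholtz s Om x w Hs Hopen Hx HN HE0) as (A & B & Hw).
  destruct (helmholtz (- s) Om' x' w' ltac:(lra) Hopen' Hx' HN' HE0')
    as (A' & B' & Hw').
  destruct (outgoing_trace s (- s) Sh Om' x0 w' A' B' g) as (E' & F' & _ & _ & Eg');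
    auto; [lra|].
  assert (Hgain : gain s (- s) = 0%C).
  { unfold gain, Cdiv. rewrite <- RtoC_mult, <- RtoC_plus.
    replace (1 + s * - s) with 0 by lra. ring. }
  destruct (outgoing_trace s s Sh Om x0 w A B g) as (E & F & HE & HF & Eg); auto.
  rewrite Hgain in Eg'. rewrite Eg' in Eg. clear Eg' Hgain.
  apply C2_eq in Eg. destruct Eg as [G1 G2]. components.
  rewrite Cmult_0_l in G1, G2. symmetry in G1, G2.
  assert (Hgs := gain_neq_0 s Hs).
  apply Cmult_eq_0_r in G1; [|exact Hgs]. apply Cmult_eq_0_r in G1; [|exact hl1].
  apply Cmult_eq_0_r in G2; [|exact Hgs]. apply Cmult_eq_0_r in G2; [|exact hl2].
  assert (HD := symbol_denominator_neq_0).
  assert (HssC : (RtoC s * RtoC s)%C = 1%C) by (rewrite <- RtoC_mult; now f_equal).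
  assert (HDk : D = (- (ik k * ik k) - RtoC s * RtoC s * l1 * l2)%C).
  { unfold D. rewrite ik_sqr, HssC, <- RtoC_mult.
    replace (k ^ 2) with (k * k) by ring. ring. }
  assert (HA : A = 0%C).
  { apply (Cmult_eq_0_r (D * E)%C); [now apply Cmult_neq_0|].
    transitivity (RtoC s * l2 * (ik k * (F * B) - RtoC s * l1 * (E * A))
                    - ik k * (ik k * (E * A) + RtoC s * l2 * (F * B)))%C.
    - rewrite HDk; ring.
    - rewrite G1, G2; ring. }
  assert (HB : B = 0%C).
  { apply (Cmult_eq_0_r (D * F)%C); [now apply Cmult_neq_0|].
    transitivity (- (ik k * (ik k * (F * B) - RtoC s * l1 * (E * A)))
                    - RtoC s * l1 * (ik k * (E * A) + RtoC s * l2 * (F * B)))%C.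
    - rewrite HDk; ring.
    - rewrite G1, G2; ring. }
  rewrite (Hw x Hx), HA, HB. unfold outgoing, bimode.
  apply vec_ext; components; ring.
Qed.

End Mode.

(** * Convergence in two iterations *)

(** The interface of the neighbour lies in the closure of the subdomain, which
    is where [0 <= delta] is used: limits taken from inside are then unique. *)
Lemma within_lt_proper (c x0 : R) :
  x0 <= c -> ProperFilter (within (fun x => x < c) (locally x0)).
Proof.
  intros H. split; [|apply within_filter, locally_filter].
  intros P [eps HP]. exists (x0 - eps / 2). destruct eps as [e He]; simpl in *.
  apply HP; [|lra].
  change (Rabs (x0 - e / 2 - x0) < e). rewrite Rabs_left; lra.
Qed.

Lemma within_gt_proper (c x0 : R) :
  c <= x0 -> ProperFilter (within (fun x => c < x) (locally x0)).
Proof.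
  intros H. split; [|apply within_filter, locally_filter].
  intros P [eps HP]. exists (x0 + eps / 2). destruct eps as [e He]; simpl in *.
  apply HP; [|lra].
  change (Rabs (x0 + e / 2 - x0) < e). rewrite Rabs_right; lra.
Qed.

Lemma S1_symbol_signed (lam mu rho omega k : R) :
  S1_symbol lam mu rho omega k = signed_symbol lam mu rho omega k 1.
Proof.
  unfold signed_symbol; rewrite !Cmult_1_l.
  destruct (S1_symbol lam mu rho omega k); reflexivity.
Qed.

Lemma S2_symbol_signed (lam mu rho omega k : R) :
  S2_symbol lam mu rho omega k = signed_symbol lam mu rho omega k (-1).
Proof.
  replace (signed_symbol lam mu rho omega k (-1)) with
    (signed_symbol lam mu rho omega k (- (1))) by (f_equal; lra).
  unfold signed_symbol, S2_symbol; rewrite RtoC_opp; f_equal; ring.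
Qed.

Theorem theorem3p2
  (lam mu rho omega delta : R)
  (hlam : 0 < lam) (hmu : 0 < mu) (hrho : 0 < rho) (homega : 0 < omega)
  (hdelta : 0 <= delta)
  (f u : field) (u1 u2 : nat -> field) (e1h e2h : nat -> R -> R -> C2)
  (hschwarz : schwarz lam mu rho omega delta
                (S1_symbol lam mu rho omega) (S2_symbol lam mu rho omega)
                f u u1 u2 e1h e2h) :
  ae (fun k =>
    (forall x, Omega1 delta x -> e1h 2%nat x k = zero) /\
    (forall x, Omega2 x -> e2h 2%nat x k = zero)).
Proof.
  destruct hschwarz as [_ _ _ _ _ _ _ M1 M2 T1 T2].
  specialize (T1 2%nat ltac:(lia)); specialize (T2 2%nat ltac:(lia)).
  generalize (ae_and _ _
    (* where [lambda1] or [lambda2] vanishes, one component of the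
       transmission condition becomes trivial *)
    (ae_and _ _ (ae_sqr_neq (omega ^ 2 / Cs mu rho ^ 2))
                (ae_sqr_neq (omega ^ 2 / Cp lam mu rho ^ 2)))
    (ae_and _ _
      (ae_and _ _ (M1 1%nat ltac:(lia)) (M1 2%nat ltac:(lia)))
      (ae_and _ _
        (ae_and _ _ (M2 1%nat ltac:(lia)) (M2 2%nat ltac:(lia)))
        (ae_and _ _ T1 T2)))).
  apply ae_mono; clear M1 M2 T1 T2.
  intros k [[K1 K2] [[E11 E12] [[E21 E22] [(g1 & T1 & T1') (g2 & T2 & T2')]]]].
  assert (hl1 : lambda1 mu rho omega k <> 0%C) by (apply csqrt_neq_0; lra).
  assert (hl2 : lambda2 lam mu rho omega k <> 0%C) by (apply csqrt_neq_0; lra).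
  assert (O1 : open (Omega1 delta)) by apply open_lt.
  assert (O2 : open Omega2) by apply open_gt.
  split.
  - apply (schwarz_step lam mu rho omega k hlam hmu hrho homega hl1 hl2 1 (-1)
      (S1_symbol lam mu rho omega) (Omega1 delta) Omega2 delta
      (fun x => e1h 2%nat x k) (fun x => e2h 1%nat x k) g1); auto; try lra.
    + apply S1_symbol_signed.
    + apply within_lt_proper; lra.
    + apply within_gt_proper; exact hdelta.
  - apply (schwarz_step lam mu rho omega k hlam hmu hrho homega hl1 hl2 (-1) 1
      (S2_symbol lam mu rho omega) Omega2 (Omega1 delta) 0
      (fun x => e2h 2%nat x k) (fun x => e1h 1%nat x k) g2); auto; try lra.
    + apply S2_symbol_signed.
    + apply within_gt_proper; lra.
    + apply within_lt_proper; exact hdelta.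
Qed.
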